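(* For $i\in\{1,2,3\}$, the non-trivial (i.e. $\{\cdot,\cdot\}^i\neq0$) Hom-Leibniz algebra $(\mathcal{V}^{q},\{\cdot,\cdot\}^i,\alpha)$ induced by $P_d^i$ is multiplicative if and only if $i=3$ and $q=-1$.
   Context: $\mathbb{K}$ is a field of characteristic zero, $q\in\mathbb{K}\setminus\{0\}$ and $d\in\mathbb{Z}$. For $n\in\mathbb{Z}$ put $\{n\}=\frac{1-q^n}{1-q}$ if $q\neq1$ and $\{n\}=n$ if $q=1$. $\mathcal{V}^q$ is the $\mathbb{K}$-vector space with basis $\{L_n\mid n\in\mathbb{Z}\}$, and $\alpha$ is the linear map $\alpha(L_n)=(1+q^n)L_n$. The Hom-Leibniz algebras $(\mathcal{V}^q,\{\cdot,\cdot\}^i,\alpha)$ induced by the homogeneous averaging operators $P_d^i$ on the $q$-deformed Witt Hom-algebra have the following bilinear products, for all $m,n\in\mathbb{Z}$: (1) $\{L_m,L_n\}^{1}=(\beta+\nu\delta_{m+d,0})(m-n)L_{m+n}$, where $q=1$ and $d\in\mathbb{Z}$; (2) $\{L_m,L_n\}^{2}=\big(\mu\frac{m}{m+d}\gamma\,\delta_{m,\mathbb{Z}\setminus\{-d\}}\big)(m-n)L_{m+n}$, where $q=1$ and $d\in\mathbb{Z}$; (3) $\{L_m,L_n\}^{3}=(\beta+\nu\delta_{q^{m},1})(\{m\}-\{n\})L_{m+n}$, where $q\neq1$ and $q^d=1$; with $\beta,\nu\in\mathbb{K}$, $\gamma\in\mathbb{K}\setminus\{0\}$, $\mu\in\{0,1\}$.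 Here $\delta_{x,y}=1$ if $x=y$ and $0$ otherwise; $\delta_{m,\mathbb{Z}\setminus\{-d\}}=1$ if $m\neq-d$ and $0$ if $m=-d$, and an expression containing this factor is read as $0$ when the factor vanishes. A Hom-algebra $(A,\{\cdot,\cdot\},\alpha)$ is multiplicative if $\alpha(\{x,y\})=\{\alpha(x),\alpha(y)\}$ for all $x,y\in A$. *)

(* Defs.v *)
From HB Require Import structures.
From mathcomp Require Import all_boot all_order all_algebra.
From mathcomp Require Import finmap.
From mathcomp.multinomials Require Import monalg.

Set Implicit Arguments.
Unset Strict Implicit.
Unset Printing Implicit Defensive.

Import GRing.Theory.
Local Open Scope ring_scope.

Record homAlgebra (K : fieldType) := HomAlgebra {
  carrier :> lmodType K;
  hprod : {bilinear carrier -> carrier -> carrier};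
  twist : {linear carrier -> carrier} }.

Definition hom_multiplicative (K : fieldType) (A : homAlgebra K) : Prop :=
  forall x y : A, twist A (hprod A x y) = hprod A (twist A x) (twist A y).

Definition nontrivial (K : fieldType) (A : homAlgebra K) : Prop :=
  ~ (forall x y : A, hprod A x y = 0).

(* The free K-module on int: finitely supported functions int -> K. *)
Notation wittV K := {malg K[int]}.

Definition L (K : fieldType) (n : int) : wittV K := << 1 *g n >>.

Section LinearExtension.
Context (K : fieldType) (V : lmodType K).

Definition linext (f : int -> V) (x : wittV K) : V :=
  \sum_(n <- msupp x) x@_n *: f n.

Lemma linextEw (f : int -> V) (x : wittV K) (D : {fset int}) :
  (msupp x `<=` D)%fset -> linext f x = \sum_(n <- D) x@_n *: f n.
Proof.
move=> sxD; rewrite /linext (big_fset_incl _ sxD) // => n _ nx.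
by rewrite mcoeff_outdom // scale0r.
Qed.

Lemma linext_is_linear (f : int -> V) : linear (linext f).
Proof.
move=> a x y.
pose D := (msupp (a *: x + y)%R `|` (msupp x `|` msupp y))%fset.
rewrite (@linextEw f (a *: x + y) D) ?fsubsetUl //.
rewrite (@linextEw f x D); last first.
  exact: fsubset_trans (fsubsetUl _ _) (fsubsetUr _ _).
rewrite (@linextEw f y D); last first.
  exact: fsubset_trans (fsubsetUr _ _) (fsubsetUr _ _).
rewrite scaler_sumr -big_split; apply: eq_bigr => n _ /=.
by rewrite mcoeffD mcoeffZ scalerDl scalerA.
Qed.

HB.instance Definition _ (f : int -> V) :=
  GRing.isLinear.Build K (wittV K) V *:%R (linext f) (linext_is_linear f).

Lemma linextL (f : int -> V) (n : int) : linext f (L K n) = f n.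
Proof.
rewrite (@linextEw f _ [fset n]%fset) ?msuppU_le //.
by rewrite big_seq_fset1 mcoeffUU scale1r.
Qed.

Definition bilext (f : int -> int -> V) (x y : wittV K) : V :=
  linext (fun m => linext (f m) y) x.

Lemma bilext_is_bilinear (f : int -> int -> V) :
  bilinear_for *:%R *:%R (bilext f).
Proof.
split=> [y|x] a u v; first exact: linext_is_linear.
have E m : linext (f m) (a *: u + v) = a *: linext (f m) u + linext (f m) v.
  exact: linext_is_linear.
transitivity (a *: bilext f x u + bilext f x v) => //.
rewrite /bilext [LHS]/linext.
under eq_bigr => m _ do rewrite E scalerDr scalerA mulrC -scalerA.
by rewrite big_split -scaler_sumr.
Qed.

HB.instance Definition _ (f : int -> int -> V) :=
  bilinear_isBilinear.Build K (wittV K) (wittV K) V *:%R *:%R (bilext f)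
    (bilext_is_bilinear f).

Lemma bilextL (f : int -> int -> V) (m n : int) :
  bilext f (L K m) (L K n) = f m n.
Proof. by rewrite /bilext !linextL. Qed.

End LinearExtension.

Definition qnum (K : fieldType) (q : K) (n : int) : K :=
  if q == 1 then n%:~R else (1 - q ^ n) / (1 - q).

Definition walpha (K : fieldType) (q : K) : {linear wittV K -> wittV K} :=
  linext (fun n => (1 + q ^ n) *: L K n).

Inductive bracket_index := Bracket1 | Bracket2 | Bracket3.

Definition bracket_cond (K : fieldType) (q : K) (d : int) (i : bracket_index) : Prop :=
  match i with
  | Bracket1 | Bracket2 => q = 1
  | Bracket3 => q <> 1 /\ q ^ d = 1
  end.

(* In Bracket2 the division by m + d is guarded: the whole coefficient is 0 at
   m = - d. *)
Definition bracket_coef (K : fieldType) (q : K) (d : int)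
    (beta nu gamma mu : K) (i : bracket_index) (m n : int) : K :=
  match i with
  | Bracket1 => (beta + nu * (m + d == 0)%:R) * (m - n)%:~R
  | Bracket2 => (if m != - d then mu * (m%:~R / (m + d)%:~R) * gamma else 0)
            * (m - n)%:~R
  | Bracket3 => (beta + nu * (q ^ m == 1)%:R) * (qnum q m - qnum q n)
  end.

Definition wprod (K : fieldType) (q : K) (d : int) (beta nu gamma mu : K)
    (i : bracket_index) : {bilinear wittV K -> wittV K -> wittV K} :=
  bilext (fun m n => bracket_coef q d beta nu gamma mu i m n *: L K (m + n)).

Definition wittHL (K : fieldType) (q : K) (d : int) (beta nu gamma mu : K)
    (i : bracket_index) : homAlgebra K :=
  HomAlgebra (wprod q d beta nu gamma mu i) (walpha q).

(* Main.v *)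
Require Import Defs.
From mathcomp Require Import all_boot all_order all_algebra.
From mathcomp.multinomials Require Import monalg.
From mathcomp Require Import ring.

Import GRing.Theory.
Local Open Scope ring_scope.

(** Write [c m n] for the coefficient of [L (m + n)] in the bracket of [L m]
    and [L n].  Applying the twist to the bracket multiplies it by
    [1 + q ^ (m + n)], while twisting both arguments multiplies it by
    [(1 + q ^ m) * (1 + q ^ n)].  The two factors differ by [q ^ m + q ^ n], so
    multiplicativity says exactly that [c m n * (q ^ m + q ^ n) = 0] for all
    [m] and [n] ([hom_multiplicativeE]).

    For [q = 1] the factor [q ^ m + q ^ n] is [2], which is nonzero in
    characteristic zero, so every [c m n] vanishes and the algebra is trivial.
    For [q != 1], [c m n] is a factor [lam m], depending on [m] only, times
    [(q ^ n - q ^ m) / (1 - q)], so the condition becomes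
    [lam m * (q ^ n - q ^ m) * (q ^ n + q ^ m) = 0].  It holds when [q = -1],
    because all [q ^ n] then have square [1].  Conversely, for [n = m + 1] the
    difference of squares is [q ^ m ^+ 2 * (q ^+ 2 - 1)]; if [q ^+ 2 != 1], this
    forces every [lam m] to vanish and again the algebra is trivial.  Hence
    [q ^+ 2 = 1], and [q = -1]. *)

(** The span of the [L n] is everything, in the form of an induction principle:
    it reduces an identity between bilinear expressions to basis vectors, one
    argument at a time. *)
Lemma wittV_ind (K : fieldType) (P : {malg K[int]} -> Prop) :
    P 0 -> (forall a x y, P x -> P y -> P (a *: x + y)) ->
    (forall n, P (L K n)) ->
  forall x, P x.
Proof.
move=> P0 PD PL x; rewrite [x]monalgE.
elim: (X in \sum_(k <- X) _) => [|k s IHs]; first by rewrite big_nil.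
rewrite big_cons; have -> : << x@_k *g k >> = x@_k *: L K k.
  by apply/malgP=> j; rewrite mcoeffZ !mcoeffU mulr_natr.
exact: PD.
Qed.

Section WittHomLeibniz.
Context (K : fieldType) (q : K) (d : int) (beta nu gamma mu : K).
Context (i : bracket_index).

Let A := wittHL q d beta nu gamma mu i.
Let c := bracket_coef q d beta nu gamma mu i.

Lemma hprodL (m n : int) : hprod A (L K m) (L K n) = c m n *: L K (m + n).
Proof. exact: bilextL. Qed.

Lemma twistL (n : int) : twist A (L K n) = (1 + q ^ n) *: L K n.
Proof. exact: linextL. Qed.

Lemma bracket_coef0_trivial :
  (forall m n, c m n = 0) -> forall x y : A, hprod A x y = 0.
Proof.
move=> c0; elim/wittV_ind => [y|a x x' IHx IHx' y|m].
- exact: linear0l.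
- by rewrite linearPl IHx IHx' scaler0 addr0.
elim/wittV_ind => [|a y y' IHy IHy'|n].
- exact: linear0r.
- by rewrite linearPr IHy IHy' scaler0 addr0.
by rewrite hprodL c0 scale0r.
Qed.

(** Both sides of the multiplicativity identity at [L m] and [L n] are multiples
    of the same basis vector [L (m + n)], so only their coefficients have to be
    compared. *)
Lemma hom_multiplicativeE : q != 0 ->
  hom_multiplicative A <-> forall m n, c m n * (q ^ m + q ^ n) = 0.
Proof.
move=> q0.
have defect m n : c m n * (q ^ m + q ^ n) =
    (1 + q ^ m) * ((1 + q ^ n) * c m n) - c m n * (1 + q ^ (m + n)).
  by rewrite expfzDr //; ring.
have twist_hprodL m n : twist A (hprod A (L K m) (L K n)) =
    (c m n * (1 + q ^ (m + n))) *: L K (m + n).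
  by rewrite hprodL linearZ /= twistL scalerA.
have hprod_twistL m n : hprod A (twist A (L K m)) (twist A (L K n)) =
    ((1 + q ^ m) * ((1 + q ^ n) * c m n)) *: L K (m + n).
  by rewrite !twistL linearZl_LR linearZr_LR hprodL -!scalerA.
split=> [multA m n|c0].
  have := multA (L K m) (L K n); rewrite twist_hprodL hprod_twistL.
  move/(congr1 (mcoeff (m + n))); rewrite !mcoeffZ mcoeffUU !mulr1 defect => ->.
  exact: subrr.
elim/wittV_ind => [y|a x x' IHx IHx' y|m].
- by rewrite linear0l !linear0 linear0l.
- by rewrite linearPl !linearP linearPl IHx IHx'.
elim/wittV_ind => [|a y y' IHy IHy'|n].
- by rewrite !linear0.
- by rewrite !linearP IHy IHy'.
rewrite twist_hprodL hprod_twistL; congr (_ *: _).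
by apply/esym/eqP; rewrite -subr_eq0 -defect c0.
Qed.

End WittHomLeibniz.

Lemma qnumB (K : fieldType) (q : K) (m n : int) : q != 1 ->
  qnum q m - qnum q n = (q ^ n - q ^ m) / (1 - q).
Proof. by move=> /negPf q1; rewrite /qnum q1 -mulrBl; congr (_ / _); ring. Qed.

Theorem proposition3p9 (K : fieldType) (charK : [pchar K] =i pred0)
    (q : K) (q_neq0 : q <> 0) (d : int)
    (beta nu gamma mu : K) (gamma_neq0 : gamma <> 0) (mu01 : mu = 0 \/ mu = 1)
    (i : bracket_index) (Hi : bracket_cond q d i)
    (Hnontrivial : nontrivial (wittHL q d beta nu gamma mu i)) :
  hom_multiplicative (wittHL q d beta nu gamma mu i) <->
  (i = Bracket3 /\ q = -1).
Proof.
have /eqP q0 := q_neq0; rewrite hom_multiplicativeE //.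
have trivial_q1 : q = 1 -> ~ (forall m n,
    bracket_coef q d beta nu gamma mu i m n * (q ^ m + q ^ n) = 0).
  move=> q1 c0; apply: Hnontrivial; apply: bracket_coef0_trivial => m n.
  apply/eqP; have /eqP := c0 m n; rewrite mulf_eq0 => /orP[//|].
  have -> : q ^ m + q ^ n = 2%:R by rewrite q1 !exp1rz.
  by have /pcharf0P -> := charK.
case: i Hi Hnontrivial trivial_q1 => [q1 _ /(_ q1) nc|q1 _ /(_ q1) nc|].
- by split=> [/nc|[]].
- by split=> [/nc|[]].
move=> [/eqP q1 _] nontriv _ /=; have q1' : 1 - q != 0 by rewrite subr_eq0 eq_sym.
split=> [c0|[_ qN1] m n]; last first.
  have sqr1 k : q ^ k * q ^ k = 1 by rewrite -expfzMl qN1 mulrNN mulr1 exp1rz.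
  rewrite qnumB //.
  transitivity ((beta + nu * (q ^ m == 1)%:R) / (1 - q) *
                (q ^ n * q ^ n - q ^ m * q ^ m)); first by ring.
  by rewrite !sqr1 subrr mulr0.
split=> //; apply/eqP.
have [//|qN1] := eqVneq q (-1).
case: nontriv; apply: bracket_coef0_trivial => m n /=.
suff -> : beta + nu * (q ^ m == 1)%:R = 0 by rewrite mul0r.
have qm0 : q ^ m != 0 by rewrite expfz_neq0.
have qN1' : 1 + q != 0 by rewrite addrC addr_eq0.
(* The choice n = m + 1 makes q ^ n - q ^ m and q ^ n + q ^ m equal, up to
   sign and a power of q, to 1 - q and 1 + q, hence both nonzero. *)
apply/eqP; have /eqP := c0 m (m + 1); rewrite qnumB // expfzDr // expr1z.
have -> : q ^ m * q - q ^ m = - (q ^ m * (1 - q)) by ring.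
have -> : q ^ m + q ^ m * q = q ^ m * (1 + q) by ring.
by rewrite !mulf_eq0 oppr_eq0 mulf_eq0 invr_eq0 (negPf qm0) (negPf q1')
  (negPf qN1') !orbF.
Qed.
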